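(* Let $\mathbb F_q$ be a finite field of characteristic $2$, and let $(C_i\subsetneq\mathbb F_q^n)_{i\in[t]}$ be a collection of proper classical codes with product-expansion at least $\rho>0$. Then there exists $\rho'=\rho'(\rho,t)>0$ depending only on $\rho$ and $t$ such that for every subcode $C_t'\subseteq C_t$, the collection $(C_1,\dots,C_{t-1},C_t')$ has product-expansion at least $\rho'$.
   Context: Product-expansion: For codes $C_1\subseteq\mathbb F_q^{n_1},\dots,C_t\subseteq\mathbb F_q^{n_t}$, identify $\mathbb F_q^{n_1}\otimes\cdots\otimes\mathbb F_q^{n_t}$ with $t$-dimensional arrays; a direction-$i$ column is the vector in $\mathbb F_q^{n_i}$ obtained by fixing all coordinates except the $i$-th. $C^{(i)}$ is the space of arrays all of whose direction-$i$ columns lie in $C_i$, and $C_1\boxplus\cdots\boxplus C_t=C^{(1)}+\cdots+C^{(t)}$. $|c|$ is the number of nonzero entries of an array, $|c|_i$ its number of nonzero direction-$i$ columns. The product-expansion of $(C_i)_{i\in[t]}$ is the largest $\rho\ge0$ such that every $c\in C_1\boxplus\cdots\boxplus C_t$ has a decomposition $c=c_1+\cdots+c_t$ with $c_i\in C^{(i)}$ and $|c|\ge\rho\sum_in_i|c_i|_i$. *)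

(* Defs.v *)
(* Codes are subspaces of F^n represented as row spaces of
   n x n matrices (mxalgebra); t-dimensional arrays over [n]^t are finite
   functions on {ffun 'I_t -> 'I_n}. *)
From mathcomp Require Import all_boot all_order all_algebra.
From mathcomp Require Import all_reals.
Set Implicit Arguments. Unset Strict Implicit. Unset Printing Implicit Defensive.
Import Order.TTheory GRing.Theory Num.Theory.
Local Open Scope ring_scope.

Section ProductExpansion.
Variables (F : fieldType) (t n : nat).

Definition point := {ffun 'I_t -> 'I_n}.
Definition array := {ffun point -> F}.

Definition upd (x : point) (i : 'I_t) (k : 'I_n) : point :=
  [ffun j => if j == i then k else x j].

Definition dcol (c : array) (i : 'I_t) (x : point) : 'rV[F]_n :=
  \row_(k < n) c (upd x i k).

Definition colkey (i : 'I_t) (x : point) : {ffun 'I_t -> option 'I_n} :=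
  [ffun j => if j == i then None else Some (x j)].

Definition wt (c : array) : nat := #|[set x : point | c x != 0]|.

Definition wtdir (c : array) (i : 'I_t) : nat :=
  #|[set colkey i x | x in [set x : point | dcol c i x != 0]]|.

Definition in_dircode (C : 'M[F]_n) (i : 'I_t) (c : array) : Prop :=
  forall x : point, (dcol c i x <= C)%MS.

Definition in_boxplus (C : 'I_t -> 'M[F]_n) (c : array) : Prop :=
  exists d : 'I_t -> array,
    (forall i, in_dircode (C i) i (d i)) /\ c = \sum_(i < t) d i.

(* the collection (C_i) has product-expansion at least rho
   (all lengths n_i equal n here) *)
Definition pexp_atleast (R : realType) (C : 'I_t -> 'M[F]_n) (rho : R) : Prop :=
  forall c : array, in_boxplus C c ->
    exists d : 'I_t -> array,
      [/\ forall i, in_dircode (C i) i (d i),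
          c = \sum_(i < t) d i &
          rho * (\sum_(i < t) (n * wtdir (d i) i)%:R) <= (wt c)%:R].

End ProductExpansion.

(* Main.v *)
(* Write c = \sum_i d_i with d_t in C'_t^(t), and let e be a decomposition of c
   witnessing the product-expansion of (C_i), so rho * cost e <= |c|, where
   cost e = \sum_i n |e_i|_i.  Choose Q with C'_t Q = 0 and v - v Q in C'_t for
   every v, and let f be e_t with its direction-t columns multiplied by Q.
   Applying Q along direction t to \sum_i d_i = \sum_i e_i shows that
   f = \sum_(i < t) Q (d_i - e_i) lies in C^(1) + ... + C^(t-1).  Because C_t is
   proper, such arrays are expanded by (C_i) with the same rho through
   decompositions h whose t-th component vanishes, so
   rho * cost h <= |f| <= n |f|_t <= cost e.  Then e + h - f (f in slot t) is a
   decomposition of c for (C_1, ..., C'_t), of cost at most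
   cost e + cost h + cost e <= (2 + 1/rho) cost e, whence
   rho' = rho^2 / (2 rho + 1). *)

From HB Require Import structures.
Require Import Defs.
From mathcomp Require Import all_boot all_order all_algebra all_field.
From mathcomp Require Import all_reals.
From mathcomp Require Import lra.
Set Implicit Arguments. Unset Strict Implicit. Unset Printing Implicit Defensive.
Import Order.TTheory GRing.Theory Num.Theory.
Local Open Scope ring_scope.

Section Arrays.
Variables (F : fieldType) (t n : nat).
Local Notation point := (point t n).
Local Notation array := (array F t n).

Lemma upd_same (x : point) i k : upd x i k i = k.
Proof. by rewrite ffunE eqxx. Qed.

Lemma upd_other (x : point) i j k : j != i -> upd x i k j = x j.
Proof. by move=> ji; rewrite ffunE (negPf ji). Qed.

Lemma upd_upd (x : point) i k l : upd (upd x i k) i l = upd x i l.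
Proof. by apply/ffunP=> j; rewrite !ffunE; case: (j == i). Qed.

Lemma upd_id (x : point) i : upd x i (x i) = x.
Proof. by apply/ffunP=> j; rewrite !ffunE; case: eqP => // ->. Qed.

Lemma upd_comm (x : point) i j k l : i != j ->
  upd (upd x i k) j l = upd (upd x j l) i k.
Proof.
move=> ij; apply/ffunP=> m; rewrite !ffunE.
by case: (eqVneq m j) => [mj|//]; case: eqP => // mi; rewrite -mi mj eqxx in ij.
Qed.

Lemma dcol_upd (c : array) i x k : dcol c i (upd x i k) = dcol c i x.
Proof. by apply/rowP=> m; rewrite !mxE upd_upd. Qed.

Lemma dcolE (c : array) i x : dcol c i x 0 (x i) = c x.
Proof. by rewrite mxE upd_id. Qed.

Lemma dcol0 i x : dcol (0 : array) i x = 0.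
Proof. by apply/rowP=> m; rewrite !mxE ffunE. Qed.

Lemma dcolD (c1 c2 : array) i x :
  dcol (c1 + c2) i x = dcol c1 i x + dcol c2 i x.
Proof. by apply/rowP=> m; rewrite !mxE ffunE. Qed.

Lemma dcolN (c : array) i x : dcol (- c) i x = - dcol c i x.
Proof. by apply/rowP=> m; rewrite !mxE ffunE. Qed.

Lemma dcol_sum (I : finType) (c : I -> array) i x :
  dcol (\sum_k c k) i x = \sum_k dcol (c k) i x.
Proof.
exact: (big_morph (fun c => dcol c i x) (fun a b => dcolD a b i x) (dcol0 i x)).
Qed.

Lemma dcols_eq0 (c : array) i : (forall x, dcol c i x = 0) -> c = 0.
Proof. by move=> c0; apply/ffunP=> x; rewrite -(dcolE c i) c0 ffunE mxE. Qed.

Definition dirmx (i : 'I_t) (A : 'M[F]_n) (c : array) : array :=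
  [ffun x => \sum_(k < n) c (upd x i k) * A k (x i)].

Lemma dirmx_is_zmod_morphism i A : zmod_morphism (dirmx i A).
Proof.
move=> c d; apply/ffunP=> x; rewrite !ffunE -sumrB.
by apply: eq_bigr => k _; rewrite !ffunE mulrBl.
Qed.

HB.instance Definition _ i A := GRing.isZmodMorphism.Build array array
  (dirmx i A) (dirmx_is_zmod_morphism i A).

Lemma dirmxE (c : array) i A x : dirmx i A c x = (dcol c i x *m A) 0 (x i).
Proof. by rewrite ffunE mxE; apply: eq_bigr => k _; rewrite mxE. Qed.

Lemma dcol_dirmx (c : array) i A x : dcol (dirmx i A c) i x = dcol c i x *m A.
Proof. by apply/rowP=> m; rewrite mxE dirmxE dcol_upd upd_same. Qed.

Lemma dcol_dirmx_other (c : array) i j A x : j != i ->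
  dcol (dirmx i A c) j x = \sum_(k < n) A k (x i) *: dcol c j (upd x i k).
Proof.
move=> ji; apply/rowP=> m; rewrite !mxE ffunE summxE.
apply: eq_bigr => k _; rewrite !mxE mulrC upd_other 1?eq_sym //.
by rewrite upd_comm.
Qed.

Lemma dirmx_comp (c : array) i A B : dirmx i B (dirmx i A c) = dirmx i (A *m B) c.
Proof. by apply/ffunP=> x; rewrite !dirmxE dcol_dirmx mulmxA. Qed.

Lemma dirmx1 (c : array) i : dirmx i 1%:M c = c.
Proof. by apply/ffunP=> x; rewrite dirmxE mulmx1 dcolE. Qed.

Lemma dirmx_summx (I : finType) (c : array) i (A : I -> 'M[F]_n) :
  dirmx i (\sum_k A k) c = \sum_k dirmx i (A k) c.
Proof.
apply/ffunP=> x; rewrite sum_ffunE dirmxE mulmx_sumr summxE.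
by apply: eq_bigr => k _; rewrite dirmxE.
Qed.

Lemma dircode0 (C : 'M[F]_n) i : in_dircode C i (0 : array).
Proof. by move=> x; rewrite dcol0 sub0mx. Qed.

Lemma dircodeD (C : 'M[F]_n) i (c1 c2 : array) :
  in_dircode C i c1 -> in_dircode C i c2 -> in_dircode C i (c1 + c2).
Proof. by move=> C1 C2 x; rewrite dcolD addmx_sub. Qed.

Lemma dircodeB (C : 'M[F]_n) i (c1 c2 : array) :
  in_dircode C i c1 -> in_dircode C i c2 -> in_dircode C i (c1 - c2).
Proof. by move=> C1 C2 x; rewrite dcolD dcolN addmx_sub // eqmx_opp. Qed.

Lemma dircode_sum (C : 'M[F]_n) i (I : finType) (c : I -> array) :
  (forall k, in_dircode C i (c k)) -> in_dircode C i (\sum_k c k).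
Proof. by move=> Cc x; rewrite dcol_sum; apply: summx_sub => k _; apply: Cc. Qed.

Lemma dircodeS (C D : 'M[F]_n) i (c : array) :
  (C <= D)%MS -> in_dircode C i c -> in_dircode D i c.
Proof. by move=> CD Cc x; apply: submx_trans (Cc x) CD. Qed.

Lemma dircode_dirmx_other (C : 'M[F]_n) i j A (c : array) :
  j != i -> in_dircode C j c -> in_dircode C j (dirmx i A c).
Proof.
by move=> ji Cc x; rewrite dcol_dirmx_other // summx_sub // => k _; rewrite scalemx_sub.
Qed.

Lemma dirmx_dircode_eq0 (C : 'M[F]_n) i A (c : array) :
  C *m A = 0 -> in_dircode C i c -> dirmx i A c = 0.
Proof.
move=> CA0 Cc; apply: (@dcols_eq0 _ i) => x; rewrite dcol_dirmx.
by apply/eqP; rewrite -submx0 -CA0 submxMr.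
Qed.

End Arrays.

Section Weights.
Variables (F : fieldType) (t n : nat).
Local Notation point := (point t n).
Local Notation array := (array F t n).

Lemma card_slices (P : pred point) i :
  #|[set x | P x]| = (\sum_(z < n) #|[set x : point | (x i == z) && P x]|)%N.
Proof.
rewrite -sum1_card (partition_big (fun x : point => x i) predT) //=.
by apply: eq_bigr => z _; rewrite -sum1_card; apply: eq_bigl => x; rewrite !inE andbC.
Qed.

(* Each nonzero direction-i column meets every slice [x i = z] exactly once. *)
Lemma wtdir_slice (c : array) i (z : 'I_n) :
  wtdir c i = #|[set x : point | (x i == z) && (dcol c i x != 0)]|.
Proof.
rewrite /wtdir -(@card_in_imset _ _ (colkey i)); last first.
  move=> x y; rewrite !inE => /andP[/eqP xz _] /andP[/eqP yz _] /ffunP xy.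
  apply/ffunP=> j; case: (eqVneq j i) => [->|ji]; first by rewrite xz yz.
  by move: (xy j); rewrite !ffunE (negPf ji) => -[].
apply: eq_card => k; apply/imsetP/imsetP => -[x]; rewrite !inE.
- move=> cx ->; exists (upd x i z); first by rewrite inE upd_same eqxx dcol_upd.
  by apply/ffunP=> j; rewrite !ffunE; case: (j == i).
- by move=> /andP[_ cx] ->; exists x; rewrite ?inE.
Qed.

Lemma wt_le_wtdir (c : array) i : (wt c <= n * wtdir c i)%N.
Proof.
rewrite /wt (card_slices _ i) -[n in (n * _)%N]card_ord -sum_nat_const.
apply: leq_sum => z _; rewrite (wtdir_slice c i z); apply: subset_leq_card.
apply/subsetP => x; rewrite !inE => /andP[-> cx] /=.
by apply: contra cx => /eqP c0; rewrite -(dcolE c i) c0 mxE.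
Qed.

Lemma leq_wtdir (c1 c2 : array) i :
  (forall x, dcol c1 i x != 0 -> dcol c2 i x != 0) -> (wtdir c1 i <= wtdir c2 i)%N.
Proof.
move=> c12; apply: subset_leq_card; apply/subsetP => k /imsetP[x]; rewrite inE => cx ->.
by apply/imsetP; exists x; rewrite ?inE ?c12.
Qed.

Lemma wtdir0 i : wtdir (0 : array) i = 0%N.
Proof.
apply/eqP; rewrite cards_eq0; apply/eqP/setP => k; rewrite inE.
by apply/imsetP => -[x]; rewrite inE dcol0 eqxx.
Qed.

Lemma wtdirD (c1 c2 : array) i : (wtdir (c1 + c2)%R i <= wtdir c1 i + wtdir c2 i)%N.
Proof.
apply: leq_trans (leq_card_setU _ _); apply: subset_leq_card.
apply/subsetP => k /imsetP[x]; rewrite inE dcolD => cx ->.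
rewrite inE; case: (eqVneq (dcol c1 i x) 0) => [c1x|c1x]; apply/orP.
  by rewrite c1x add0r in cx; right; apply/imsetP; exists x; rewrite ?inE.
by left; apply/imsetP; exists x; rewrite ?inE.
Qed.

Lemma wtdirN (c : array) i : wtdir (- c) i = wtdir c i.
Proof.
by apply/eqP; rewrite eqn_leq !leq_wtdir // => x; rewrite dcolN ?oppr_eq0.
Qed.

Lemma wtdir_sum (I : finType) (c : I -> array) i :
  (wtdir (\sum_k c k)%R i <= \sum_k wtdir (c k) i)%N.
Proof.
apply: (big_ind2 (fun a b => wtdir a i <= b)%N); first by rewrite wtdir0.
  by move=> a1 b1 a2 b2 ab1 ab2; apply: leq_trans (wtdirD _ _ _) (leq_add ab1 ab2).
by [].
Qed.

Lemma wtdir_dirmx (c : array) i A : (wtdir (dirmx i A c) i <= wtdir c i)%N.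
Proof.
by apply: leq_wtdir => x; rewrite dcol_dirmx; apply: contra => /eqP ->; rewrite mul0mx.
Qed.

(* Only the slice [x i = k0] of c contributes to the direction-j columns of
   [dirmx i A c]. *)
Lemma wtdir_dirmx_col (c : array) (i j : 'I_t) (A : 'M[F]_n) (k0 : 'I_n) :
  (forall l m, m != k0 -> A l m = 0) -> j != i ->
  (wtdir (dirmx i A c) j <= wtdir c j)%N.
Proof.
move=> A0 ji; rewrite (wtdir_slice _ j k0) (wtdir_slice c j k0).
set S := [set x : point | _ & dcol c j x != 0].
apply: leq_trans (leq_imset_card (fun y => upd y i k0) S).
apply: subset_leq_card; apply/subsetP => x; rewrite inE => /andP[/eqP xj].
rewrite dcol_dirmx_other // => Acx.
have xi : x i = k0.
  apply/eqP; apply: contraNT Acx => xi.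
  by apply/eqP; apply: big1 => k _; rewrite A0 // scale0r.
have [k ck | c0] := pickP (fun k => dcol c j (upd x i k) != 0); last first.
  move: Acx; rewrite big1 ?eqxx // => k _.
  by move/negbFE/eqP: (c0 k) => ->; rewrite scaler0.
apply/imsetP; exists (upd x i k); first by rewrite inE upd_other // xj eqxx ck.
by rewrite upd_upd -xi upd_id.
Qed.

(* [dirmx i (delta_mx k j0) c] moves the slice [x i = k] of c onto the slice
   [x i = j0] and vanishes elsewhere. *)
Lemma wt_dirmx_delta (c : array) i (k j0 : 'I_n) :
  (wt (dirmx i (delta_mx k j0) c) <= #|[set x : point | (x i == k) && (c x != 0%R)]|)%N.
Proof.
apply: leq_trans (leq_imset_card (fun y => upd y i j0) _).
apply: subset_leq_card; apply/subsetP => p; rewrite inE ffunE.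
rewrite (bigD1 k) //= big1 => [|l lk]; last by rewrite mxE (negPf lk) mulr0.
rewrite addr0 mxE eqxx /=; have [pj|] := eqVneq (p i) j0; last by rewrite mulr0 eqxx.
rewrite mulr1 => cp; apply/imsetP; exists (upd p i k).
  by rewrite inE upd_same eqxx.
by rewrite upd_upd -pj upd_id.
Qed.

Definition cost (d : 'I_t -> array) : nat := \sum_(i < t) n * wtdir (d i) i.

Lemma costE (R : numDomainType) (d : 'I_t -> array) :
  \sum_(i < t) (n * wtdir (d i) i)%:R = (cost d)%:R :> R.
Proof. by rewrite natr_sum. Qed.

Lemma costD (d1 d2 : 'I_t -> array) :
  (cost (fun i => (d1 i + d2 i)%R) <= cost d1 + cost d2)%N.
Proof.
by rewrite -big_split /= leq_sum // => i _; rewrite -mulnDr leq_mul2l wtdirD orbT.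
Qed.

Lemma costN (d : 'I_t -> array) : cost (fun i => - d i) = cost d.
Proof. by apply: eq_bigr => i _; rewrite wtdirN. Qed.

Lemma cost_single (r : 'I_t) (f : array) :
  cost (fun i => if i == r then f else 0) = (n * wtdir f r)%N.
Proof.
rewrite /cost (bigD1 r) //= eqxx big1 ?addn0 // => i /negPf ->.
by rewrite wtdir0 muln0.
Qed.

Lemma wtdir_le_cost (d : 'I_t -> array) r : (n * wtdir (d r) r <= cost d)%N.
Proof. by rewrite /cost (bigD1 r) //= leq_addr. Qed.

Lemma cost_correction (e h : 'I_t -> array) r (f : array) :
  (cost (fun i => e i + h i - (if i == r then f else 0))%R <=
   cost e + cost h + n * wtdir f r)%N.
Proof.
apply: leq_trans (costD (fun i => e i + h i) (fun i => - (if i == r then f else 0))) _.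
by rewrite costN cost_single leq_add2r costD.
Qed.

End Weights.

Lemma proper_code_annihilators (F : fieldType) n (C : 'M[F]_n) :
  (\rank C < n)%N ->
  exists j0 (N : 'I_n -> 'M[F]_n), [/\ \sum_k delta_mx k j0 *m N k = 1%:M,
    forall k, C *m N k = 0 & forall k l m, m != k -> N k l m = 0].
Proof.
move=> C_proper; have [K CK0 /matrix0Pn[j0 [l0 Kj0]]] :
    exists2 K : 'M_n, C *m K = 0 & K != 0.
  exists (cokermx C); first exact: mulmx_coker.
  apply: contraTneq C_proper => K0; move: (mxrank_coker C).
  by rewrite K0 mxrank0 => /esym/eqP; rewrite subn_eq0 leqNgt.
pose v : 'cV_n := (K j0 l0)^-1 *: col l0 K.
have v_j0 : row j0 v = 1 by rewrite [LHS]mx11_scalar !mxE mulVf.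
exists j0, (fun k => v *m delta_mx 0 k); split.
- rewrite mx1_sum_delta; apply: eq_bigr => k _.
  rewrite -(mul_delta_mx (0 : 'I_1) k j0) -!mulmxA (mulmxA _ v) -rowE v_j0.
  by rewrite mul1mx mul_delta_mx.
- by move=> k; rewrite mulmxA /v -scalemxAr colE mulmxA CK0 !(mul0mx, scaler0).
- by move=> k l m mk; rewrite mxE big_ord1 !mxE (negPf mk) andbF mulr0.
Qed.

Section AvoidingSlot.
Variables (R : realType) (F : fieldType) (t n : nat).
Variables (C : 'I_t -> 'M[F]_n) (rho : R) (r : 'I_t).
Hypotheses (rho_ge0 : 0 <= rho) (C_proper : (\rank (C r) < n)%N).
Hypothesis C_pexp : pexp_atleast C rho.

(* Slice G along direction r, move the k-th slice onto coordinate j0 with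
   [delta_mx k j0], expand it there, and pull the expansion back with N k; the
   r-th components vanish because N k annihilates C r. *)
Lemma pexp_avoiding_slot (g : 'I_t -> array F t n) :
  (forall i, in_dircode (C i) i (g i)) -> g r = 0 ->
  exists h : 'I_t -> array F t n,
    [/\ forall i, in_dircode (C i) i (h i), h r = 0,
        \sum_i h i = \sum_i g i & rho * (cost h)%:R <= (wt (\sum_i g i))%:R].
Proof.
move=> gC gr; set G := \sum_i g i.
have [j0 [N [sumN CN N_col]]] := proper_code_annihilators C_proper.
have slice_exp k : exists e : 'I_t -> array F t n,
    [/\ forall i, in_dircode (C i) i (e i), \sum_i e i = dirmx r (delta_mx k j0) G &
        rho * (cost e)%:R <= (wt (dirmx r (delta_mx k j0) G))%:R].
  have Gk : in_boxplus C (dirmx r (delta_mx k j0) G).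
    exists (fun i => dirmx r (delta_mx k j0) (g i)); split; last by rewrite raddf_sum.
    move=> i; have [->|ir] := eqVneq i r; first by rewrite gr raddf0; apply: dircode0.
    exact: dircode_dirmx_other.
  by have [e [eC eG e_exp]] := C_pexp Gk; exists e; rewrite -costE -eG.
have [e e_spec] := fin_all_exists slice_exp.
pose h i := \sum_k dirmx r (N k) (e k i).
have hr : h r = 0.
  by apply: big1 => k _; apply: (dirmx_dircode_eq0 (CN k)); case: (e_spec k).
have cost_h : (cost h <= \sum_k cost (e k))%N.
  rewrite /cost exchange_big /= leq_sum // => i _; rewrite -big_distrr leq_mul2l /=.
  apply/orP; right; have [->|ir] := eqVneq i r; first by rewrite hr wtdir0.
  apply: leq_trans (wtdir_sum _ _) _; apply: leq_sum => k _.
  exact: wtdir_dirmx_col (N_col k) ir.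
have slices : (\sum_k wt (dirmx r (delta_mx k j0) G) <= wt G)%N.
  rewrite /wt (card_slices (fun x => G x != 0) r).
  by apply: leq_sum => k _; apply: wt_dirmx_delta.
exists h; split => //.
- move=> i; have [->|ir] := eqVneq i r; first by rewrite hr; apply: dircode0.
  by apply: dircode_sum => k; apply: dircode_dirmx_other => //; case: (e_spec k).
- rewrite exchange_big /= -(dirmx1 G r) -sumN dirmx_summx; apply: eq_bigr => k _.
  by case: (e_spec k) => _ eG _; rewrite -raddf_sum eG /= dirmx_comp.
apply: le_trans (_ : rho * (\sum_k cost (e k))%:R <= _).
  by rewrite ler_wpM2l ?ler_nat.
rewrite natr_sum mulr_sumr.
apply: le_trans (_ : \sum_k (wt (dirmx r (delta_mx k j0) G))%:R <= _).
  by apply: ler_sum => k _; case: (e_spec k).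
by rewrite -natr_sum ler_nat.
Qed.

End AvoidingSlot.

Lemma subspace_annihilator (F : fieldType) n (C' : 'M[F]_n) :
  exists Q : 'M_n, C' *m Q = 0 /\ forall v : 'rV_n, (v - v *m Q <= C')%MS.
Proof.
exists (1%:M - proj_mx C' C'^C%MS); split.
  by rewrite mulmxBr mulmx1 proj_mx_id ?subrr ?capmx_compl.
by move=> v; rewrite mulmxBr mulmx1 opprB addrC subrK proj_mx_sub.
Qed.

Section SubcodeDefect.
Variables (F : fieldType) (t n : nat) (C : 'I_t -> 'M[F]_n) (r : 'I_t) (C' : 'M[F]_n).
Variables dA e : 'I_t -> array F t n.
Hypotheses (sum_dA_e : \sum_i dA i = \sum_i e i) (dA_r : in_dircode C' r (dA r)).
Hypotheses (dA_C : forall i, i != r -> in_dircode (C i) i (dA i))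
           (e_C : forall i, i != r -> in_dircode (C i) i (e i)).

(* With C' Q = 0, the defect f := Q e_r (applied along r) equals
   \sum_(i != r) Q (dA_i - e_i), so it decomposes without using slot r. *)
Lemma subcode_defect :
  exists f (g : 'I_t -> array F t n),
    [/\ forall i, in_dircode (C i) i (g i), g r = 0, \sum_i g i = f,
        in_dircode C' r (e r - f) & (wtdir f r <= wtdir (e r) r)%N].
Proof.
have [Q [C'Q QC']] := subspace_annihilator C'.
exists (dirmx r Q (e r)), (fun i => if i == r then 0 else dirmx r Q (dA i - e i)).
split; rewrite ?eqxx ?wtdir_dirmx //.
- move=> i; have [_|ir] := eqVneq i r; first exact: dircode0.
  by apply: dircode_dirmx_other => //; apply: dircodeB; [apply: dA_C | apply: e_C].
- have : \sum_i dirmx r Q (dA i - e i) = 0.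
    by rewrite -raddf_sum sumrB sum_dA_e subrr raddf0.
  rewrite (bigD1 r) //= raddfB /= (dirmx_dircode_eq0 C'Q dA_r) sub0r addrC => /eqP.
  rewrite subr_eq0 => /eqP <-; rewrite (bigD1 r) //= eqxx add0r.
  by apply: eq_bigr => i /negPf ->.
- by move=> x; rewrite dcolD dcolN dcol_dirmx QC'.
Qed.

End SubcodeDefect.

Lemma subcode_expansion_bound (R : realFieldType) (rho Se Sh Sf W : R) :
  0 < rho -> 0 <= Sh -> rho * Se <= W -> rho * Sh <= Sf -> Sf <= Se ->
  rho ^+ 2 / (2 * rho + 1) * (Se + Sh + Sf) <= W.
Proof.
move=> rho_gt0 Sh_ge0 Se_W Sh_Sf Sf_Se.
rewrite mulrAC ler_pdivrMr; last by lra.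
have : rho * (rho * Sh) <= rho * Se by rewrite ler_pM2l //; lra.
nra.
Qed.

Theorem lemmaA2 (R : realType) (t : nat) (rho : R) :
  0 < rho ->
  exists rho' : R, 0 < rho' /\
    forall (F : finFieldType) (n : nat) (C : 'I_t.+1 -> 'M[F]_n),
      (2 \in [pchar F])%N ->
      (forall i, \rank (C i) < n)%N ->
      pexp_atleast C rho ->
      forall C' : 'M[F]_n, (C' <= C ord_max)%MS ->
        pexp_atleast (fun i => if i == ord_max then C' else C i) rho'.
Proof.
move=> rho_gt0; have rho'_gt0 : 0 < rho ^+ 2 / (2 * rho + 1).
  by apply: divr_gt0; [exact: exprn_gt0 | lra].
exists (rho ^+ 2 / (2 * rho + 1)); split=> //.
move=> F n C _ C_proper C_pexp C' C'C _ [dA [dA_C ->]].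
set r : 'I_t.+1 := ord_max.
have dA_r : in_dircode C' r (dA r) by have := dA_C r; rewrite eqxx.
have dA_i i : i != r -> in_dircode (C i) i (dA i).
  by move=> ir; have := dA_C i; rewrite (negPf ir).
have [|e [e_C sum_e e_exp]] := C_pexp (\sum_i dA i).
  exists dA; split=> // i; have [->|/dA_i//] := eqVneq i r; exact: dircodeS C'C dA_r.
have [f [g [g_C g_r sum_g e_f f_wt]]] :=
  subcode_defect sum_e dA_r dA_i (fun i _ => e_C i).
have [h [h_C h_r sum_h h_exp]] :=
  pexp_avoiding_slot (ltW rho_gt0) (C_proper r) C_pexp g_C g_r.
exists (fun i => e i + h i - (if i == r then f else 0)); split.
- move=> i; have [->|ir] := eqVneq i r; first by rewrite h_r addr0.
  by rewrite subr0; apply: dircodeD; [apply: e_C | apply: h_C].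
- by rewrite sumrB big_split /= -big_mkcond big_pred1_eq sum_h sum_g addrK.
rewrite costE; rewrite costE in e_exp; rewrite sum_g in h_exp.
apply: le_trans
  (_ : _ <= rho ^+ 2 / (2 * rho + 1) * (cost e + cost h + n * wtdir f r)%:R) _.
  by rewrite ler_wpM2l ?ler_nat ?ltW ?cost_correction.
rewrite !natrD; apply: (subcode_expansion_bound rho_gt0 (ler0n _ _) e_exp).
  by apply: le_trans h_exp _; rewrite ler_nat wt_le_wtdir.
by rewrite ler_nat; apply: leq_trans (wtdir_le_cost e r); rewrite leq_mul2l f_wt orbT.
Qed.
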